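(* Let $E$ be a finite or countable set and let $H$ be a closed subspace of $\ell^2(E)$. Let $\mathfrak{B}$ be a random subset of $E$ with law $\mathbf{P}^H$. Then $H_{\mathfrak{B}} = [\mathfrak{B}]$ $\mathbf{P}^H$-almost surely.
   Context: $\ell^2(E)$ is the real or complex Hilbert space whose standard orthonormal basis is identified with $E$. For a closed subspace $H$, $P_H$ is the orthogonal projection onto $H$, and $\mathbf{P}^H$ is the unique Borel probability measure on $2^E$ such that a random set $\mathfrak{B}$ with law $\mathbf{P}^H$ satisfies $\mathbf{P}^H[A\subseteq\mathfrak{B}] = \det[(P_He,f)]_{e,f\in A}$ for all finite $A\subseteq E$ (such a measure exists). For $B\subseteq E$, $[B]$ is the closed linear span of $\{e : e\in B\}$ in $\ell^2(E)$, and $H_B$ is the closure of the image $P_{[B]}H$ of $H$ under the orthogonal projection $P_{[B]}$. *)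

(* Defs.v *)
From HB Require Import structures.
From mathcomp Require Import all_boot all_order all_algebra.
From mathcomp Require Import complex.
From mathcomp Require Import all_classical all_reals all_analysis.
From mathcomp Require Import finmap ring.
From mathcomp Require summability.
Set Implicit Arguments.
Unset Strict Implicit.
Unset Printing Implicit Defensive.
Import Order.TTheory GRing.Theory Num.Theory.
Import numFieldNormedType.Exports.
Local Open Scope classical_set_scope.
Local Open Scope ring_scope.

Variant scalar_kind := RealScalars | ComplexScalars.

Definition scalars (R : realType) (k : scalar_kind) : numFieldType :=
  match k with RealScalars => R | ComplexScalars => R[i] end.

Definition of_real (R : realType) (k : scalar_kind) : R -> scalars R k :=
  match k with
  | RealScalars => fun x => x
  | ComplexScalars => fun x => (x%:C)%C
  end.

Definition re_part (R : realType) (k : scalar_kind) : scalars R k -> R :=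
  match k with
  | RealScalars => fun x => x
  | ComplexScalars => fun z => complex.Re z
  end.

Definition sconj (R : realType) (k : scalar_kind) : scalars R k -> scalars R k :=
  match k with
  | RealScalars => fun x => x
  | ComplexScalars => fun z => (z^*)%C
  end.

(* The library norm of [scalars R k] takes values in [scalars R k] itself. *)
Definition modulus (R : realType) (k : scalar_kind) (z : scalars R k) : R :=
  re_part `|z|.

Section modulus_theory.
Context (R : realType) (k : scalar_kind).
Implicit Types y z : scalars R k.

Lemma of_real_modulus z : of_real k (modulus z) = `|z|.
Proof.
by rewrite /modulus; case: k z => [|[]].
Qed.

Lemma modulus_ge0 z : 0 <= modulus z.
Proof.
rewrite /modulus; case: k z => /= [z|[a b] /=]; first exact: normr_ge0.
exact: sqrtr_ge0.
Qed.

Lemma of_real_inj : injective (@of_real R k).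
Proof. by case: k => // x y [->]. Qed.

Lemma of_real_le (x y : R) : (of_real k x <= of_real k y) = (x <= y).
Proof. by case: k => //=; rewrite lecR. Qed.

Lemma of_realD (x y : R) : of_real k (x + y) = of_real k x + of_real k y.
Proof. by case: k => //=; rewrite rmorphD. Qed.

Lemma of_realM (x y : R) : of_real k (x * y) = of_real k x * of_real k y.
Proof. by case: k => //=; rewrite rmorphM. Qed.

Lemma of_real0 : of_real k (0 : R) = 0.
Proof. by case: k. Qed.

Lemma modulusM y z : modulus (y * z) = modulus y * modulus z.
Proof. by apply: of_real_inj; rewrite of_realM !of_real_modulus normrM. Qed.

Lemma modulusD y z : modulus (y + z) <= modulus y + modulus z.
Proof. by rewrite -of_real_le of_realD !of_real_modulus ler_normD. Qed.

Lemma modulus0 : modulus (0 : scalars R k) = 0.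
Proof. by apply: of_real_inj; rewrite of_real_modulus normr0 of_real0. Qed.

Lemma modulus1 : modulus (1 : scalars R k) = 1.
Proof.
by apply: of_real_inj; rewrite of_real_modulus normr1; case: k.
Qed.

Lemma modulus0_eq0 z : modulus z = 0 -> z = 0.
Proof.
by move=> z0; apply/eqP; rewrite -normr_eq0 -of_real_modulus z0 of_real0.
Qed.

End modulus_theory.

Section sqsum.
Context (R : realType) (k : scalar_kind) (E : countType).
Local Notation K := (scalars R k).
Implicit Types x y : E -> K.

Definition sqsum x : \bar R := \esum_(e in [set: E]) (modulus (x e) ^+ 2)%:E.

Definition l2_pred : {pred E -> K} := [pred x | `[< (sqsum x < +oo)%E >]].

Lemma l2_predP x : reflect (sqsum x < +oo)%E (x \in l2_pred).
Proof. exact: asboolP. Qed.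

Lemma sqsum_ge0 x : (0 <= sqsum x)%E.
Proof. by apply: esum_ge0 => e _; rewrite lee_fin sqr_ge0. Qed.

Lemma sqsum_leP x (c : R) :
  (sqsum x <= c%:E)%E <->
  forall A : {fset E}, \sum_(e <- A) modulus (x e) ^+ 2 <= c.
Proof.
split=> [xc A|xc].
  rewrite -lee_fin (le_trans _ xc)//; apply: esum_ge.
  exists [set` A]; first by split.
  by rewrite fsbig_finite//= set_fsetK sumEFin.
apply: ge_ereal_sup => _ [X [finX _] <-].
by rewrite fsbig_finite//= sumEFin lee_fin.
Qed.

Lemma sqsumZ (a : K) x c :
  (sqsum x <= (c ^+ 2)%:E)%E ->
  (sqsum (fun e => a * x e)%R <= ((modulus a * c) ^+ 2)%:E)%E.
Proof.
move=> /sqsum_leP xc; apply/sqsum_leP => A.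
under eq_bigr do rewrite modulusM exprMn.
by rewrite -mulr_sumr exprMn ler_wpM2l ?sqr_ge0.
Qed.

Lemma sqsumD x y (s t : R) : 0 < s -> 0 < t ->
  (sqsum x <= (s ^+ 2)%:E)%E -> (sqsum y <= (t ^+ 2)%:E)%E ->
  (sqsum (fun e => x e + y e)%R <= ((s + t) ^+ 2)%:E)%E.
Proof.
move=> s0 t0 /sqsum_leP xs /sqsum_leP yt; apply/sqsum_leP => A.
have bnd (e : E) : modulus (x e + y e)%R ^+ 2 <=
    (s + t) * (modulus (x e) ^+ 2 / s + modulus (y e) ^+ 2 / t).
  have := modulusD (x e) (y e); have := modulus_ge0 (x e + y e)%R.
  move: (modulus _) (modulus _) (modulus _) => b a m m0 mab.
  have le1 : m ^+ 2 <= (a + b) ^+ 2 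
    by rewrite !expr2 ler_pM.
  apply: (le_trans le1); rewrite -subr_ge0.
  suff -> : (s + t) * (a ^+ 2 / s + b ^+ 2 / t) - (a + b) ^+ 2 =
            (t * a - s * b) ^+ 2 / (s * t).
    by rewrite divr_ge0 ?sqr_ge0 ?mulr_ge0 ?ltW.
  have sn0 : s != 0 by rewrite gt_eqF.
  have tn0 : t != 0 by rewrite gt_eqF.
  apply: (mulIf (mulf_neq0 sn0 tn0)); rewrite divfK ?mulf_neq0//.
  have ha : a ^+ 2 / s * (s * t) = a ^+ 2 * t by rewrite mulrA divfK.
  have hb : b ^+ 2 / t * (s * t) = b ^+ 2 * s by rewrite [s * t]mulrC mulrA divfK.
  by rewrite mulrBl -mulrA [X in (s + t) * X]mulrDl ha hb; ring.
apply: (le_trans (ler_sum _ (fun e _ => bnd e))).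
rewrite -mulr_sumr big_split/= -!mulr_suml [leRHS]expr2 ler_wpM2l//; first by rewrite ltW// addr_gt0.
by rewrite lerD// ler_pdivrMr// -expr2.
Qed.

Lemma l2_submod_closed : submod_closed l2_pred.
Proof.
have l2E x : x \in l2_pred ->
    exists2 s, 0 < s & (sqsum x <= (s ^+ 2)%:E)%E.
  move=> /l2_predP xoo; have xfin : (sqsum x \is a fin_num).
    by rewrite ge0_fin_numE// sqsum_ge0.
  have f0 : 0 <= fine (sqsum x) by rewrite fine_ge0// sqsum_ge0.
  exists (Num.sqrt (fine (sqsum x)) + 1).
    by rewrite ltr_wpDl ?sqrtr_ge0.
  rewrite -[leLHS]fineK// lee_fin -[leLHS]sqr_sqrtr// ler_sqr ?nnegrE.
  - by rewrite lerDl.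
  - by rewrite sqrtr_ge0.
  - by rewrite addr_ge0 ?sqrtr_ge0.
split=> [|a x y /l2E[s s0 xs] /l2E[t t0 yt]].
  apply/l2_predP; apply: (@le_lt_trans _ _ 0%E); last exact: ltry.
  by rewrite /sqsum esum1// => e _; rewrite /= modulus0 expr0n.
apply/l2_predP; apply: le_lt_trans (ltry (((modulus a + 1) * s + t) ^+ 2)).
apply: sqsumD => //; first by rewrite mulr_gt0// ltr_wpDl ?modulus_ge0.
apply: (le_trans (sqsumZ a xs)); rewrite lee_fin ler_sqr ?nnegrE.
- by rewrite ler_wpM2r ?ltW// ltrDl.
- by rewrite mulr_ge0 ?modulus_ge0 ?ltW.
- by rewrite mulr_ge0 ?addr_ge0 ?modulus_ge0 ?ltW.
Qed.

HB.instance Definition _ :=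
  GRing.isSubmodClosed.Build K (E -> K) l2_pred l2_submod_closed.

End sqsum.

Record l2 (R : realType) (k : scalar_kind) (E : countType) := L2 {
  l2_fun :> E -> scalars R k;
  _ : l2_fun \in @l2_pred R k E }.

Section l2_theory.
Context (R : realType) (k : scalar_kind) (E : countType).
Local Notation K := (scalars R k).
Local Notation l2 := (l2 R k E).
Implicit Types x y : l2.

HB.instance Definition _ := [isSub for @l2_fun R k E].
HB.instance Definition _ := [Choice of l2 by <:].
HB.instance Definition _ := [SubChoice_isSubLmodule of l2 by <:].

Definition l2_norm_real x : R := Num.sqrt (fine (sqsum x)).

Definition l2_norm x : K := of_real k (l2_norm_real x).

Lemma l2_norm_realE x : (sqsum x = (l2_norm_real x ^+ 2)%:E)%E.
Proof.
rewrite /l2_norm_real sqr_sqrtr ?fine_ge0 ?sqsum_ge0// fineK//.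
by rewrite ge0_fin_numE ?sqsum_ge0//; apply/l2_predP; case: x.
Qed.

Lemma l2_norm_real_le x (c : R) : 0 <= c ->
  (sqsum x <= (c ^+ 2)%:E)%E = (l2_norm_real x <= c).
Proof.
by move=> c0; rewrite l2_norm_realE lee_fin ler_pXn2r// ?nnegrE ?sqrtr_ge0.
Qed.

Lemma l2_norm0_eq0 x : l2_norm x = 0 -> x = 0.
Proof.
rewrite -[RHS](of_real0 R k) => /of_real_inj n0; apply/val_inj/funext => e /=.
apply: modulus0_eq0; apply/eqP; rewrite -sqrf_eq0 eq_le sqr_ge0 andbT.
have /sqsum_leP/(_ [fset e]%fset) : (sqsum x <= 0%:E)%E.
  by rewrite l2_norm_realE n0 expr0n.
by rewrite big_seq_fset1.
Qed.

Lemma l2_normD x y : l2_norm (x + y) <= l2_norm x + l2_norm y.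
Proof.
rewrite /l2_norm -of_realD of_real_le; apply/ler_addgt0Pr => eps eps0.
have eps20 : 0 < eps / 2 by rewrite divr_gt0.
have le2 z : l2_norm_real z <= l2_norm_real z + eps / 2 by rewrite lerDl ltW.
have gt2 z : 0 < l2_norm_real z + eps / 2 by rewrite ltr_wpDl ?sqrtr_ge0.
rewrite [eps]splitr addrACA -l2_norm_real_le; last by rewrite ltW// addr_gt0.
by apply: sqsumD; rewrite ?l2_norm_real_le// ltW.
Qed.

Lemma l2_normZ (a : K) x : l2_norm (a *: x) = `|a| * l2_norm x.
Proof.
rewrite /l2_norm -of_real_modulus -of_realM; congr of_real.
have leZ b z : l2_norm_real (b *: z) <= modulus b * l2_norm_real z.
  rewrite -l2_norm_real_le ?mulr_ge0 ?modulus_ge0 ?sqrtr_ge0//.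
  by apply: sqsumZ; rewrite l2_norm_realE.
apply/eqP; rewrite eq_le leZ/=.
have [->|a0] := eqVneq a 0.
  by rewrite modulus0 mul0r sqrtr_ge0.
have ma0 : 0 < modulus a.
  rewrite lt_neqAle modulus_ge0 andbT eq_sym.
  by apply: contra_neq a0; exact: modulus0_eq0.
have /(ler_wpM2l (ltW ma0)) := leZ a^-1 (a *: x).
by rewrite scalerA mulVf// scale1r mulrA -modulusM divff// modulus1 mul1r.
Qed.

HB.instance Definition _ := @Lmodule_isNormed.Build K l2
  l2_norm l2_normD l2_normZ l2_norm0_eq0.

Lemma l2_basis_subproof (e : E) :
  (fun f => (f == e)%:R : K) \in @l2_pred R k E.
Proof.
apply/l2_predP; apply: le_lt_trans (ltry (1 : R)).
apply/sqsum_leP => A.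
have [eA|eA] := boolP (e \in A).
  rewrite (big_fsetD1 e)//= eqxx modulus1 expr1n big_seq big1 ?addr0// => f.
  by rewrite !inE => /andP[/negbTE-> _]; rewrite modulus0 expr0n.
rewrite big_seq big1// => f fA; rewrite (_ : f == e = false) ?modulus0 ?expr0n//.
by apply: contraNF eA => /eqP <-.
Qed.

Definition l2_basis (e : E) : l2 := L2 (l2_basis_subproof e).

(* [summability.sum] is the limit of the finite partial sums along the
   directed set of finite subsets of [E]; the family below is absolutely
   summable, so the limit exists. *)
Definition l2_inner x y : K := summability.sum (fun e => x e * sconj (y e)).

(* [0] is a dummy value: for a closed subspace [V] the projection of [x] is the
   unique point of the set below. *)
Definition orth_proj (V : set l2) (x : l2) : l2 :=
  xget 0 [set p | V p /\ forall v, V v -> l2_inner (x - p) v = 0].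

Definition linear_span (S : set l2) : set l2 :=
  smallest (fun V : set l2 => submod_closed (mem V)) S.

End l2_theory.

(* Subsets of [E] are elements of the product space {0,1}^E, with its Borel
   sigma-algebra. *)
Definition subsets (E : countType) := prod_topology (fun _ : E => bool).

Definition borel_subsets (E : countType) :=
  g_sigma_algebraType (@open (subsets E)).

Section determinantal.
Context (R : realType) (k : scalar_kind) (E : countType).
Local Notation l2 := (l2 R k E).

Definition coord_subspace (B : subsets E) : set l2 :=
  closure (linear_span [set l2_basis R k e | e in [set e | B e]]).

Definition compression (H : set l2) (B : subsets E) : set l2 :=
  closure [set orth_proj (coord_subspace B) h | h in H].

Definition determinantal_law (H : set l2) (P : probability (borel_subsets E) R)
    : Prop :=
  forall A : {fset E},
    of_real k (fine (P [set B | forall e, e \in A -> (B : subsets E) e])) =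
    \det (\matrix_(i < #|{: A}|, j < #|{: A}|)
      l2_inner (orth_proj H (l2_basis R k (val (enum_val i))))
               (l2_basis R k (val (enum_val j)))).

End determinantal.

(* Main.v *)
(** Condition on the trace of the random set on a finite set [F] not containing
    [e], and let [c] be the resulting conditional probability of [e].  Since
    probabilities of cylinders are determinants of signed copies of the matrix
    of [P_H], [c] is a Schur complement, and solving the associated linear
    system produces [h] in [H] that vanishes on the part of [F] lying in the
    random set, with [h e = c] and squared norm [c] off [F].

    The event that [e] is in the random set although [c <= eps] has probability
    at most [eps]; hence almost surely, if [e] is in the random set then [c] stays
    above some [eps > 0] for arbitrarily large [F].  If [v] is supported on the
    random set and orthogonal to [H], pairing [v] with such vectors [h] leaves
    only [c * conj (v e)] and a tail of [v], so [v e = 0].  Thus a.s. no nonzero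
    vector of [[B]] is orthogonal to [H], that is, to [P_[B] H]. *)
From HB Require Import structures.
From mathcomp Require Import all_boot all_order fingroup perm all_algebra.
From mathcomp Require Import complex.
From mathcomp Require Import all_classical all_reals all_analysis.
From mathcomp Require Import finmap ring lra.
From mathcomp Require summability.
Require Import Defs.
Set Implicit Arguments.
Unset Strict Implicit.
Unset Printing Implicit Defensive.
Import Order.TTheory GRing.Theory Num.Theory.
Import numFieldNormedType.Exports.
Local Open Scope classical_set_scope.
Local Open Scope ring_scope.

(** * Real and complex scalars *)

Section scalar_theory.
Context (R : realType) (k : scalar_kind).
Local Notation K := (scalars R k).
Implicit Types y z : K.

Lemma of_real_zmod_morphism : zmod_morphism (@of_real R k).
Proof. by case: k => //= x y; rewrite rmorphB. Qed.

Lemma of_real_monoid_morphism : monoid_morphism (@of_real R k).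
Proof. by case: k => //=; split=> // x y; rewrite rmorphM. Qed.

HB.instance Definition _ :=
  GRing.isZmodMorphism.Build R K (@of_real R k) of_real_zmod_morphism.
HB.instance Definition _ :=
  GRing.isMonoidMorphism.Build R K (@of_real R k) of_real_monoid_morphism.

Lemma sconj_zmod_morphism : zmod_morphism (@sconj R k).
Proof. by case: k => //= x y; rewrite rmorphB. Qed.

Lemma sconj_monoid_morphism : monoid_morphism (@sconj R k).
Proof.
by case: k => //=; split=> [|x y]; [exact: rmorph1|exact: rmorphM].
Qed.

HB.instance Definition _ :=
  GRing.isZmodMorphism.Build K K (@sconj R k) sconj_zmod_morphism.
HB.instance Definition _ :=
  GRing.isMonoidMorphism.Build K K (@sconj R k) sconj_monoid_morphism.

Lemma sconjK : involutive (@sconj R k).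
Proof. by case: k => //= x; exact: conjcK. Qed.

Lemma mul_sconj z : z * sconj z = of_real k (modulus z ^+ 2).
Proof.
rewrite rmorphXn/= of_real_modulus; case: k z => /= z.
  by rewrite real_normK ?num_real// expr2.
by rewrite normCK.
Qed.

Lemma sconj_of_real (a : R) : sconj (of_real k a) = of_real k a.
Proof. by case: k => //=; exact: conjc_real. Qed.

Lemma modulus_sconj z : modulus (sconj z) = modulus z.
Proof.
apply/eqP; rewrite -(@eqrXn2 _ 2) ?modulus_ge0//; apply/eqP.
by apply: (@of_real_inj R k); rewrite -!mul_sconj sconjK mulrC.
Qed.

Lemma modulus_of_real (a : R) : modulus (of_real k a) = `|a|.
Proof.
apply: (@of_real_inj R k); rewrite of_real_modulus; case: k => //=.
by rewrite normc_def /= expr0n addr0 sqrtr_sqr.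
Qed.

Lemma of_real_lt (a b : R) : (of_real k a < of_real k b) = (a < b).
Proof. by rewrite !lt_neqAle of_real_le (inj_eq (@of_real_inj R k)). Qed.

(** Balls in [K] and in [l2] have radii in [K] itself; the order of [K] makes a positive radius
    real, which allows real estimates. *)
Lemma of_real_gt0 z : 0 < z -> exists2 a : R, 0 < a & z = of_real k a.
Proof.
move=> z0; have zE : z = of_real k (modulus z).
  by rewrite of_real_modulus gtr0_norm.
by exists (modulus z) => //; rewrite -of_real_lt of_real0 -zE.
Qed.

Lemma modulusN z : modulus (- z) = modulus z.
Proof. by rewrite /modulus normrN. Qed.

Lemma modulusV z : modulus z^-1 = (modulus z)^-1.
Proof. by apply: (@of_real_inj R k); rewrite fmorphV/= !of_real_modulus normfV. Qed.

(* The unit [u] is [0] for real scalars, where the last two terms vanish, and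
   the imaginary unit for complex scalars. *)
Lemma polarization : exists u : K, forall y z,
  y * sconj z = 4^-1 * ((of_real k (modulus (y + z) ^+ 2)
     - of_real k (modulus (y - z) ^+ 2))
     + u * (of_real k (modulus (y + u * z) ^+ 2)
     - of_real k (modulus (y - u * z) ^+ 2))).
Proof.
suff [u H] : exists u : K, forall y z, 4 * (y * sconj z) =
    (y + z) * sconj (y + z) - (y - z) * sconj (y - z) +
    u * ((y + u * z) * sconj (y + u * z) - (y - u * z) * sconj (y - u * z)).
  by exists u => y z; rewrite -!mul_sconj -H mulKf.
have [cid|[u cu uu]] : (forall y : K, sconj y = y) \/
    exists2 u : K, sconj u = - u & u ^+ 2 = -1.
- case: k => /=; first by left.
  right; exists 'i%C; last exact: sqr_i.
  by apply/eqP; rewrite eq_complex /= oppr0 !eqxx.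
- by exists 0 => y z; rewrite !cid; ring.
exists u => y z; rewrite !rmorphB !rmorphD !rmorphM/= cu.
transitivity (2 * (y * sconj z + z * sconj y) +
    2 * u ^+ 2 * (z * sconj y - y * sconj z)); last by ring.
by rewrite uu; ring.
Qed.

End scalar_theory.

(** * The inner product of l2(E) *)

#[local] Existing Instance summability.totally_filter.

Section inner_product.
Context (R : realType) (k : scalar_kind) (E : countType).
Local Notation K := (scalars R k).
Local Notation l2 := (l2 R k E).
Implicit Types x y z : l2.

Definition nsq x : R := l2_norm_real x ^+ 2.

Lemma nsq_ge0 x : 0 <= nsq x. Proof. exact: sqr_ge0. Qed.

Lemma sqsumE x : sqsum x = (nsq x)%:E. Proof. exact: l2_norm_realE. Qed.

Lemma sum_nsq_le x (A : {fset E}) : \sum_(e <- A) modulus (x e) ^+ 2 <= nsq x.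
Proof. by move: A; apply/sqsum_leP; rewrite sqsumE. Qed.

Lemma nsq_le x (c : R) :
  (forall A : {fset E}, \sum_(e <- A) modulus (x e) ^+ 2 <= c) -> nsq x <= c.
Proof. by move=> /sqsum_leP; rewrite sqsumE lee_fin. Qed.

Lemma sum_nsq_gt x (c : R) : c < nsq x ->
  exists A : {fset E}, c < \sum_(e <- A) modulus (x e) ^+ 2.
Proof.
move=> cx; apply: contrapT => nA; move: cx; rewrite ltNge => /negP; apply.
by apply: nsq_le => A; rewrite leNgt; apply/negP => cA; apply: nA; exists A.
Qed.

Lemma modulus_nsq_le x e : modulus (x e) ^+ 2 <= nsq x.
Proof. by have := sum_nsq_le x [fset e]%fset; rewrite big_seq_fset1. Qed.

Lemma sum_fset_le (f : E -> R) (A B : {fset E}) : (forall e, 0 <= f e) ->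
  (A `<=` B)%fset -> \sum_(e <- A) f e <= \sum_(e <- B) f e.
Proof.
move=> f0 AB; rewrite [leRHS](big_fsetID _ (mem A))/=.
rewrite (_ : [fset e in B | e \in A]%fset = A) ?lerDl ?sumr_ge0//.
apply/fsetP => e; rewrite !inE/= andbC; case: (boolP (e \in A)) => //=.
exact: (fsubsetP AB).
Qed.

Local Notation psum := (@summability.partial_sum E K).
Local Notation tot := (@summability.totally E).

Lemma psumE (u : E -> K) (A : {fset E}) : psum u A = \sum_(e <- A) u e.
Proof. by rewrite big_seq_fsetE. Qed.

Lemma psumP (u : E -> K) (l : K) :
  (forall eps : R, 0 < eps -> exists A0 : {fset E}, forall A : {fset E},
    (A0 `<=` A)%fset -> modulus (l - \sum_(e <- A) u e) <= eps) ->
  psum u @ tot --> l.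
Proof.
move=> h; apply/cvgrPdist_le => /= _ /of_real_gt0[eps eps0 ->].
have [A0 hA0] := h _ eps0; exists A0 => // A A0A /=.
by rewrite psumE -of_real_modulus of_real_le hA0.
Qed.

Lemma cvg_psum_nsq x :
  psum (fun e => of_real k (modulus (x e) ^+ 2)) @ tot --> of_real k (nsq x).
Proof.
apply: psumP => eps eps0.
have [|A hA] := @sum_nsq_gt x (nsq x - eps); first by rewrite ltrBlDr ltrDl.
exists A => B AB; rewrite -rmorph_sum/= -rmorphB/= modulus_of_real.
rewrite ger0_norm ?subr_ge0 ?sum_nsq_le//.
have := @sum_fset_le (fun e => modulus (x e) ^+ 2) _ _ (fun=> sqr_ge0 _) AB.
by move/(lt_le_trans hA); lra.
Qed.

(** Polarization turns the partial sums into a fixed combination of partial sums of squared moduli,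
    which converge by [cvg_psum_nsq]. *)
Lemma cvg_l2_inner x y :
  psum (fun e => x e * sconj (y e)) @ tot --> l2_inner x y.
Proof.
suff : cvg (psum (fun e => x e * sconj (y e)) @ tot) by [].
have [u pol] := polarization R k.
have psD f g A : psum (fun e => f e + g e) A = psum f A + psum g A.
  by rewrite !psumE big_split.
have psM a f A : psum (fun e => a * f e) A = a * psum f A.
  by rewrite !psumE mulr_sumr.
pose q z := psum (fun e => of_real k (modulus (z e) ^+ 2)).
have cq z : cvg (q z @ tot) by apply/cvg_ex; eexists; exact: cvg_psum_nsq.
rewrite (_ : psum _ = (fun A => 4^-1 * ((q (x + y) A - q (x - y) A) +
    u * (q (x + u *: y) A - q (x - u *: y) A)))); last first.
  apply/funext => A; rewrite /q !psumE -!sumrB !mulr_sumr -big_split/= mulr_sumr.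
  by apply: eq_bigr => e _; rewrite pol.
apply: is_cvgMr; apply: is_cvgD; first exact: is_cvgB.
by apply: is_cvgMr; exact: is_cvgB.
Qed.

Lemma l2_inner_eq x y (l : K) :
  psum (fun e => x e * sconj (y e)) @ tot --> l -> l2_inner x y = l.
Proof. by move=> h; apply: cvg_lim. Qed.

Lemma l2_innerxx x : l2_inner x x = of_real k (nsq x).
Proof.
apply: l2_inner_eq; under eq_fun do rewrite mul_sconj; exact: cvg_psum_nsq.
Qed.

Lemma l2_innerP a x y z :
  l2_inner (a *: x + y) z = a * l2_inner x z + l2_inner y z.
Proof.
apply: l2_inner_eq.
rewrite (_ : psum _ = (fun A => a * psum (fun e => x e * sconj (z e)) A +
    psum (fun e => y e * sconj (z e)) A)); last first.
  apply/funext => A; rewrite !psumE mulr_sumr -big_split/=.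
  by apply: eq_bigr => e _; rewrite mulrDl mulrA.
by apply: cvgD; [apply: cvgMr|]; exact: cvg_l2_inner.
Qed.

Lemma l2_inner_conj x y : l2_inner y x = sconj (l2_inner x y).
Proof.
apply: l2_inner_eq; apply/cvgrPdist_lt => /= e e0.
have /cvgrPdist_lt/(_ _ e0) := @cvg_l2_inner x y.
apply: filterS => A /=; rewrite !psumE -!of_real_modulus => h.
rewrite (_ : \sum_(_ <- _) _ = sconj (\sum_(e <- A) x e * sconj (y e))).
  by rewrite -rmorphB/= modulus_sconj.
by rewrite rmorph_sum/=; apply: eq_bigr => i _; rewrite rmorphM/= sconjK mulrC.
Qed.

Lemma l2_innerDl x y z : l2_inner (x + y) z = l2_inner x z + l2_inner y z.
Proof. by rewrite -[x]scale1r l2_innerP mul1r scale1r. Qed.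

Lemma l2_inner0l z : l2_inner 0 z = 0.
Proof. by apply: (@addIr _ (l2_inner 0 z)); rewrite -l2_innerDl addr0 add0r. Qed.

Lemma l2_innerZl a x z : l2_inner (a *: x) z = a * l2_inner x z.
Proof. by rewrite -[a *: x]addr0 l2_innerP l2_inner0l addr0. Qed.

Lemma l2_innerBl x y z : l2_inner (x - y) z = l2_inner x z - l2_inner y z.
Proof. by rewrite addrC -scaleN1r l2_innerP mulN1r addrC. Qed.

Lemma l2_inner_suml I (r : seq I) (f : I -> l2) z :
  l2_inner (\sum_(i <- r) f i) z = \sum_(i <- r) l2_inner (f i) z.
Proof.
by apply: (big_morph (fun x => l2_inner x z)) => [x y|];
   [exact: l2_innerDl|exact: l2_inner0l].
Qed.

Lemma l2_innerDr x y z : l2_inner z (x + y) = l2_inner z x + l2_inner z y.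
Proof. by rewrite l2_inner_conj l2_innerDl rmorphD/= -!l2_inner_conj. Qed.

Lemma l2_innerZr a x z : l2_inner z (a *: x) = sconj a * l2_inner z x.
Proof. by rewrite l2_inner_conj l2_innerZl rmorphM/= -!l2_inner_conj. Qed.

Lemma l2_innerBr x y z : l2_inner z (x - y) = l2_inner z x - l2_inner z y.
Proof. by rewrite l2_inner_conj l2_innerBl rmorphB/= -!l2_inner_conj. Qed.

Lemma l2_inner0r z : l2_inner z 0 = 0.
Proof. by rewrite l2_inner_conj l2_inner0l rmorph0. Qed.

Lemma l2_inner_basis x e : l2_inner x (l2_basis R k e) = x e.
Proof.
apply: l2_inner_eq; apply: psumP => eps eps0; exists [fset e]%fset => A.
rewrite fsub1set => eA; rewrite (big_fsetD1 e)//= eqxx rmorph1 mulr1 opprD.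
rewrite addrA subrr add0r modulusN big_seq big1 ?modulus0 ?ltW// => f.
by rewrite !inE => /andP[/negPf -> _]; rewrite rmorph0 mulr0.
Qed.

(** Lets one factor be altered wherever the other vanishes, in particular restricted to a set of
    coordinates. *)
Lemma l2_inner_local x y z : (forall e, z e != 0 -> x e = y e) ->
  l2_inner x z = l2_inner y z.
Proof.
move=> xy; apply: (congr1 (@summability.sum E K K)); apply/funext => e.
have [->|/xy -> //] := eqVneq (z e) 0.
by rewrite rmorph0 !mulr0.
Qed.

Lemma nsq_eq0 x : nsq x = 0 -> x = 0.
Proof.
move=> /eqP; rewrite sqrf_eq0 => /eqP x0; apply: l2_norm0_eq0.
by rewrite /l2_norm x0 of_real0.
Qed.

Lemma nsqZ a x : nsq (a *: x) = modulus a ^+ 2 * nsq x.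
Proof.
apply: (@of_real_inj R k); rewrite -l2_innerxx l2_innerZl l2_innerZr mulrA.
by rewrite mul_sconj l2_innerxx [RHS]of_realM.
Qed.

Lemma nsqD x y : l2_inner x y = 0 -> nsq (x + y) = nsq x + nsq y.
Proof.
move=> xy; apply: (@of_real_inj R k); rewrite rmorphD/= -!l2_innerxx.
rewrite l2_innerDl !l2_innerDr xy (l2_inner_conj x y) xy rmorph0.
by rewrite addr0 add0r.
Qed.

Lemma parallelogram x y : nsq (x + y) + nsq (x - y) = 2 * nsq x + 2 * nsq y.
Proof.
apply: (@of_real_inj R k).
rewrite !rmorphD/= !(rmorphM (@of_real R k) 2) !rmorph_nat -!l2_innerxx.
by rewrite l2_innerBl !l2_innerBr l2_innerDl !l2_innerDr !l2_innerxx; ring.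
Qed.

(** Pythagoras for the component of [x] along [v]. It yields Cauchy-Schwarz and, for projections,
    the orthogonality of a minimizer. *)
Lemma nsq_sub_proj x v : v != 0 ->
  nsq x = nsq (x - (l2_inner x v / l2_inner v v) *: v) +
          modulus (l2_inner x v) ^+ 2 / nsq v.
Proof.
move=> v0; have nv0 : nsq v != 0 by apply: contra_neq v0 => /nsq_eq0.
have vv0 : l2_inner v v != 0.
  by rewrite l2_innerxx -(of_real0 R k) (inj_eq (@of_real_inj R k)).
set t := (l2_inner x v / _).
have /nsqD : l2_inner (x - t *: v) (t *: v) = 0.
  by rewrite l2_innerZr l2_innerBl l2_innerZl divfK// subrr mulr0.
rewrite subrK nsqZ => ->; congr (_ + _); rewrite /t l2_innerxx modulusM modulusV.
by rewrite modulus_of_real ger0_norm ?nsq_ge0//; field.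
Qed.

Lemma CauchySchwarz x v : modulus (l2_inner x v) ^+ 2 <= nsq x * nsq v.
Proof.
have [->|v0] := eqVneq v 0.
  by rewrite l2_inner0r modulus0 expr0n mulr_ge0 ?nsq_ge0.
have nv0 : 0 < nsq v.
  by rewrite lt_neqAle nsq_ge0 andbT eq_sym; apply: contra_neq v0 => /nsq_eq0.
by rewrite -ler_pdivrMr// (nsq_sub_proj x v0) lerDr nsq_ge0.
Qed.

End inner_product.

(** * Completeness and orthogonal projections *)

Section completeness.
Context (R : realType) (k : scalar_kind).
Local Notation K := (scalars R k).

Lemma real_cauchy_cvg (u : nat -> R) :
  (forall eps, 0 < eps -> exists N, forall m n, (N <= m)%N -> (N <= n)%N ->
    `|u m - u n| <= eps) -> cvg (u @ \oo).
Proof.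
move=> cu; apply/cauchy_cvgP/cauchy_exP => eps eps0.
have [N hN] := cu _ (divr_gt0 eps0 (@ltr0n R 2)).
exists (u N), N => // n /= Nn; rewrite /ball/=.
by apply: le_lt_trans (hN _ _ _ _) _ => //; rewrite ltr_pdivrMr// ltr_pMr// ltr1n.
Qed.

Lemma scalars_cauchy_cvg (u : nat -> K) :
  (forall eps, 0 < eps -> exists N, forall m n, (N <= m)%N -> (N <= n)%N ->
    modulus (u m - u n) <= eps) ->
  exists l, (fun m => modulus (u m - l)) @ \oo --> 0.
Proof.
case: k u => u cu.
  have /cvg_ex[/= l ul] := real_cauchy_cvg cu.
  exists l; rewrite /modulus/= -[X in _ --> X](normr0 R); apply: cvg_norm.
  by rewrite -[X in _ --> X](subrr l); apply: cvgB => //; exact: cvg_cst.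
(* Complex case: both parts are dominated by the modulus, so they are real Cauchy sequences. *)
have modE (z : R[i]) : @modulus R ComplexScalars z =
    Num.sqrt (complex.Re z ^+ 2 + complex.Im z ^+ 2).
  by case: z.
have leRe (z : R[i]) : `|complex.Re z| <= @modulus R ComplexScalars z.
  by rewrite modE -sqrtr_sqr ler_wsqrtr// lerDl sqr_ge0.
have leIm (z : R[i]) : `|complex.Im z| <= @modulus R ComplexScalars z.
  by rewrite modE -sqrtr_sqr ler_wsqrtr// lerDr sqr_ge0.
have ReB (y z : scalars R ComplexScalars) :
    complex.Re (y - z) = complex.Re y - complex.Re z by case: y z => ? ? [].
have ImB (y z : scalars R ComplexScalars) :
    complex.Im (y - z) = complex.Im y - complex.Im z by case: y z => ? ? [].
have /cvg_ex[/= a ua] : cvg ((fun n => complex.Re (u n)) @ \oo).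
  apply: real_cauchy_cvg => eps /cu[N hN]; exists N => m n Nm Nn.
  by apply: le_trans (hN _ _ Nm Nn); rewrite -ReB.
have /cvg_ex[/= b ub] : cvg ((fun n => complex.Im (u n)) @ \oo).
  apply: real_cauchy_cvg => eps /cu[N hN]; exists N => m n Nm Nn.
  by apply: le_trans (hN _ _ Nm Nn); rewrite -ImB.
exists (a +i* b)%C.
rewrite (_ : (fun m => _) = fun m => Num.sqrt
    (complex.Re (u m - (a +i* b)%C) ^+ 2 + complex.Im (u m - (a +i* b)%C) ^+ 2));
  last by apply/funext => m; exact: modE.
rewrite -[X in _ --> X]sqrtr0; apply: continuous_cvg; first exact: sqrt_continuous.
rewrite -[X in _ --> X]addr0; apply: cvgD.
  rewrite [X in _ --> X](_ : _ = (a - a) ^+ 2); last by rewrite subrr expr0n.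
  under eq_fun do rewrite ReB/= expr2.
  by rewrite expr2; apply: cvgM; apply: cvgB => //; exact: cvg_cst.
rewrite [X in _ --> X](_ : _ = (b - b) ^+ 2); last by rewrite subrr expr0n.
under eq_fun do rewrite ImB/= expr2.
by rewrite expr2; apply: cvgM; apply: cvgB => //; exact: cvg_cst.
Qed.

Lemma cvg_modulus (u : nat -> K) l z :
  (fun m => modulus (u m - l)) @ \oo --> 0 ->
  (fun m => modulus (u m - z)) @ \oo --> modulus (l - z).
Proof.
move=> /cvgrPdist_le ul; apply/cvgrPdist_le => eps /ul.
apply: filterS => m; rewrite sub0r normrN ger0_norm ?modulus_ge0//.
apply: le_trans; rewrite ler_norml; apply/andP; split.
  by have := modulusD (u m - l) (l - z); rewrite addrA subrK; lra.
have := modulusD (l - u m) (u m - z); rewrite addrA subrK.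
by rewrite -(modulusN (l - u m)) opprB; lra.
Qed.

End completeness.

(** Triangle inequality for squared norms, from [(a + b) ^+ 2 <= 2 * a ^+ 2 + 2 * b ^+ 2]. *)
Lemma sqr_le_quarters (R : realFieldType) (a b c eps : R) : 0 <= c ->
  c <= a + b -> a ^+ 2 <= eps / 4 -> b ^+ 2 <= eps / 4 -> c ^+ 2 <= eps.
Proof.
move=> c0 cab ha hb; have := sqr_ge0 (a - b).
have : c ^+ 2 <= (a + b) ^+ 2 by rewrite ler_pXn2r ?nnegrE// (le_trans c0).
by rewrite sqrrB sqrrD; lra.
Qed.

Section hilbert.
Context (R : realType) (k : scalar_kind) (E : countType).
Local Notation K := (scalars R k).
Local Notation l2 := (l2 R k E).
Implicit Types (x y z : l2) (V S : set l2).

(** Each coordinate converges in [K], and the Cauchy bound on a finite set of coordinates passes to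
    the limit, hence to the full norm. *)
Lemma l2_complete (v : nat -> l2) :
  (forall eps, 0 < eps -> exists N, forall m n, (N <= m)%N -> (N <= n)%N ->
    nsq (v m - v n) <= eps) ->
  exists p, forall eps, 0 < eps -> exists N, forall n, (N <= n)%N ->
    nsq (v n - p) <= eps.
Proof.
move=> cv.
have /choice[l vl] e : exists l, (fun m => modulus (v m e - l)) @ \oo --> 0.
  apply: scalars_cauchy_cvg => eps eps0.
  have [N hN] := cv _ (exprn_gt0 2 eps0); exists N => m n Nm Nn.
  rewrite -(@ler_pXn2r _ 2) ?nnegrE ?modulus_ge0 ?(ltW eps0)//.
  exact: le_trans (modulus_nsq_le (v m - v n) e) (hN _ _ Nm Nn).
have lim_le eps N n (A : {fset E}) :
    (forall m, (N <= m)%N -> nsq (v m - v n) <= eps) ->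
    \sum_(e <- A) modulus (l e - v n e) ^+ 2 <= eps.
  move=> hN.
  have cA : (fun m => \sum_(e <- A) modulus (v m e - v n e) ^+ 2) @ \oo -->
      \sum_(e <- A) modulus (l e - v n e) ^+ 2.
    elim: (enum_fset A) => [|e r IH]; first by under eq_fun do rewrite big_nil;
      rewrite big_nil; exact: cvg_cst.
    under eq_fun do rewrite big_cons expr2; rewrite big_cons expr2.
    by apply: cvgD => //; apply: cvgM; exact: cvg_modulus.
  rewrite -(cvg_lim _ cA)//; apply: limr_le; first by apply/cvg_ex; eexists; exact: cA.
  exists N => // m /= Nm; exact: le_trans (sum_nsq_le (v m - v n) A) (hN _ Nm).
have [N1 hN1] := cv 1 ltr01.
(* The bound first shows that the limit minus [v N1] is square-summable; adding [v N1] back then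
   gives the limit as a vector of [l2]. *)
have l2d : (fun e => l e - v N1 e) \in @l2_pred R k E.
  apply/l2_predP; apply: le_lt_trans (ltry (1 : R)); apply/sqsum_leP => A.
  by apply: (lim_le _ N1) => m Nm; exact: hN1.
exists (L2 l2d + v N1) => eps eps0; have [N hN] := cv _ eps0.
exists N => n Nn; apply: nsq_le => A.
rewrite (eq_bigr (fun e => modulus (l e - v n e) ^+ 2)) => [|e _].
  by apply: (lim_le _ N) => m Nm; exact: hN.
by rewrite -modulusN/= subrK opprB.
Qed.

Lemma l2_closureP S x : closure S x <->
  forall eps : R, 0 < eps -> exists2 y, S y & nsq (x - y) <= eps.
Proof.
split=> [cx eps eps0|h B /nbhs_ballP[_ /of_real_gt0[a a0 ->] aB]].
  have s0 : 0 < of_real k (Num.sqrt eps) by rewrite -(of_real0 R k) of_real_lt sqrtr_gt0.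
  have [y [Sy]] := cx _ (nbhsx_ballx x _ s0).
  rewrite -ball_normE/= [X in X < _](_ : _ = l2_norm (x - y))// /l2_norm.
  rewrite of_real_lt => xy; exists y => //.
  by rewrite -[leRHS]sqr_sqrtr ?(ltW eps0)// ler_pXn2r ?nnegrE ?sqrtr_ge0 ?ltW.
have [y Sy xy] := h ((a / 2) ^+ 2) (exprn_gt0 2 (divr_gt0 a0 (@ltr0n R 2))).
exists y; split=> //; apply: aB.
rewrite -ball_normE/= [X in X < _](_ : _ = l2_norm (x - y))// /l2_norm of_real_lt.
apply: le_lt_trans (_ : a / 2 < a); last by rewrite ltr_pdivrMr// ltr_pMr// ltr1n.
rewrite -(@ler_pXn2r _ 2) ?nnegrE ?sqrtr_ge0//.
by rewrite divr_ge0// ltW.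
Qed.

Lemma submod_closedP V : submod_closed (mem V) <->
  V 0 /\ forall a x y, V x -> V y -> V (a *: x + y).
Proof.
have memE x : (x \in pred_of_mem (mem V)) = (x \in V) by [].
split=> [[V0 VP]|[V0 VP]]; split.
- by move: V0; rewrite memE in_setE.
- by move=> a x y Vx Vy; have := VP a x y; rewrite !memE !in_setE; exact.
- by rewrite memE in_setE.
- by move=> a x y; rewrite !memE !in_setE; exact: VP.
Qed.

Section subspace.
Context (V : set l2) (Vsub : submod_closed (mem V)).

Lemma subspace0 : V 0. Proof. by have /submod_closedP[] := Vsub. Qed.

Lemma subspaceP a x y : V x -> V y -> V (a *: x + y).
Proof. by have /submod_closedP[_] := Vsub; exact. Qed.

Lemma subspaceZ a x : V x -> V (a *: x).
Proof. by rewrite -[a *: x]addr0 => Vx; apply: subspaceP => //; exact: subspace0. Qed.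

Lemma subspaceD x y : V x -> V y -> V (x + y).
Proof. by move=> Vx Vy; rewrite -[x]scale1r; exact: subspaceP. Qed.

Lemma subspaceB x y : V x -> V y -> V (x - y).
Proof. by move=> Vx Vy; rewrite addrC -scaleN1r; exact: subspaceP. Qed.

Lemma subspace_sum I (r : seq I) (f : I -> l2) :
  (forall i, V (f i)) -> V (\sum_(i <- r) f i).
Proof. by move=> Vf; elim/big_ind : _ => //; [exact: subspace0|exact: subspaceD]. Qed.

Lemma closure_subspace : submod_closed (mem (closure V)).
Proof.
apply/submod_closedP; split; first by apply: subset_closure; exact: subspace0.
move=> a x y /l2_closureP cx /l2_closureP cy; apply/l2_closureP => eps eps0.
(* With tolerance [eps / 2 / c] in both approximations the weighted errors add up to at most
   [eps / 2]; the parallelogram law costs the factor 2. *)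
pose c := 1 + modulus a ^+ 2.
have c0 : 0 < c by rewrite ltr_pwDl// sqr_ge0.
have e0 : 0 < eps / 2 / c by rewrite !divr_gt0.
have [x' Vx' xx'] := cx _ e0; have [y' Vy' yy'] := cy _ e0.
exists (a *: x' + y'); first exact: subspaceP.
have -> : a *: x + y - (a *: x' + y') = a *: (x - x') + (y - y').
  by rewrite scalerBr opprD addrACA.
have := parallelogram (a *: (x - x')) (y - y').
have := nsq_ge0 (a *: (x - x') - (y - y')); rewrite nsqZ.
have : modulus a ^+ 2 * nsq (x - x') + nsq (y - y') <= eps / 2.
  rewrite (_ : eps / 2 = modulus a ^+ 2 * (eps / 2 / c) + eps / 2 / c).
    by rewrite lerD// ler_wpM2l ?sqr_ge0.
  by rewrite -[X in _ + X]mul1r -mulrDl addrC [RHS]mulrC divfK ?lt0r_neq0.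
lra.
Qed.

Context (Vclosed : closed V).

(* A minimizing sequence for the distance to [x] is Cauchy by the
   parallelogram law. *)
Lemma orth_proj_exists x :
  exists p, V p /\ forall v, V v -> l2_inner (x - p) v = 0.
Proof.
pose D := [set nsq (x - v) | v in V].
have Dinf : has_inf D.
  split; first by exists (nsq (x - 0)), 0 => //; exact: subspace0.
  by exists 0 => _ [v _ <-]; exact: nsq_ge0.
have dle v : V v -> inf D <= nsq (x - v).
  by move=> Vv; apply: ge_inf; [exact: Dinf.2|exists v].
have /choice[w hw] (n : nat) : exists w, V w /\ nsq (x - w) <= inf D + n.+1%:R^-1.
  have n0 : 0 < n.+1%:R^-1 :> R by rewrite invr_gt0.
  by have [_ [w Vw <-] /ltW hw] := inf_adherent n0 Dinf; exists w.
(* The midpoint of [w m] and [w n] lies in [V], so its squared distance to [x] is at least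
   [inf D]. *)
have w_cauchy m n : nsq (w m - w n) <= 2 * m.+1%:R^-1 + 2 * n.+1%:R^-1.
  have [Vm hm] := hw m; have [Vn hn] := hw n.
  have := parallelogram (x - w n) (x - w m).
  rewrite (_ : x - w n - (x - w m) = w m - w n); last first.
    by rewrite opprB addrC addrA subrK.
  have -> : x - w n + (x - w m) = 2 *: (x - 2^-1 *: (w n + w m)).
    rewrite scalerBr scalerA mulfV ?pnatr_eq0// scale1r.
    by rewrite (scaler_nat 2 x) mulr2n opprD addrACA.
  have := dle _ (subspaceZ 2^-1 (subspaceD Vn Vm)).
  rewrite nsqZ (_ : modulus 2 = 2); last first.
    by rewrite -(@rmorph_nat _ _ (@of_real R k)) modulus_of_real normr_nat.
  move: hm hn; move: (nsq _) (nsq (w m - _)) (nsq (x - w m)) (nsq (x - w n)).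
  by move: (inf D) (m.+1%:R^-1) (n.+1%:R^-1) => d i j a b c e; lra.
have invn (eps : R) : 0 < eps -> exists N, forall n, (N <= n)%N -> n.+1%:R^-1 <= eps.
  move=> eps0; have [N _ hN] := near_infty_natSinv_lt (PosNum eps0).
  by exists N => n Nn; apply/ltW/hN.
have [|p hp] := @l2_complete w.
  move=> eps eps0; have [N hN] := invn _ (divr_gt0 eps0 (@ltr0n R 4)).
  exists N => m n /hN hm /hN hn; have := w_cauchy m n.
  by move: hm hn; move: (nsq _) (m.+1%:R^-1) (n.+1%:R^-1) => a i j; lra.
exists p; split=> [|v Vv].
  apply: Vclosed; apply/l2_closureP => eps /hp[N hN].
  exists (w N); first exact: (hw N).1.
  by rewrite -opprB -scaleN1r nsqZ modulusN modulus1 expr1n mul1r; exact: hN.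
have [->|v0] := eqVneq v 0; first exact: l2_inner0r.
have nv0 : 0 < nsq v.
  by rewrite lt_neqAle nsq_ge0 andbT eq_sym; apply: contra_neq v0 => /nsq_eq0.
(* Removing the component along [v] is a move inside [V], so it lowers the squared distance by no
   more than the excess of [w n] over [inf D]. *)
have bound n : modulus (l2_inner (x - w n) v) ^+ 2 <= n.+1%:R^-1 * nsq v.
  have [Vn hn] := hw n.
  rewrite -ler_pdivrMr//; move: (nsq_sub_proj (x - w n) v0).
  set t := l2_inner _ _ / l2_inner _ _; rewrite -addrA -opprD.
  move: hn (dle _ (subspaceD Vn (subspaceZ t Vv))).
  by move: (inf D) (n.+1%:R^-1) (nsq _) (nsq _) (_ / _) => d i a b c; lra.
apply: modulus0_eq0; apply/eqP; rewrite -sqrf_eq0 eq_le sqr_ge0 andbT.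
apply/ler_addgt0Pr => eps eps0; rewrite add0r.
(* The inner product is split at [w n]; this tolerance bounds the square of each piece by
   [eps / 4]. *)
have e0 : 0 < eps / 4 / nsq v by rewrite !divr_gt0.
have [N1 hN1] := invn _ e0; have [N2 hN2] := hp _ e0.
pose n := maxn N1 N2.
have h1 : modulus (l2_inner (x - w n) v) ^+ 2 <= eps / 4.
  by apply: le_trans (bound n) _; rewrite -ler_pdivlMr// hN1// leq_maxl.
have h2 : modulus (l2_inner (w n - p) v) ^+ 2 <= eps / 4.
  by apply: le_trans (CauchySchwarz _ _) _; rewrite -ler_pdivlMr// hN2// leq_maxr.
have := modulusD (l2_inner (x - w n) v) (l2_inner (w n - p) v).
rewrite -l2_innerDl addrA subrK => h.
exact: sqr_le_quarters (modulus_ge0 _) h h1 h2.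
Qed.

Lemma orth_projP x :
  V (orth_proj V x) /\ forall v, V v -> l2_inner (x - orth_proj V x) v = 0.
Proof.
have [p hp] := orth_proj_exists x.
by rewrite /orth_proj; case: xgetP => [_ ->//|/(_ p)].
Qed.

Lemma orth_proj_uniq x p : V p -> (forall v, V v -> l2_inner (x - p) v = 0) ->
  orth_proj V x = p.
Proof.
move=> Vp hp; have [Vq hq] := orth_projP x.
apply/eqP; rewrite -subr_eq0; apply/eqP/nsq_eq0/(@of_real_inj R k).
have Vpq := subspaceB Vq Vp.
rewrite -l2_innerxx of_real0.
rewrite -[X in l2_inner X _](_ : (x - p) - (x - orth_proj V x) = _).
  by rewrite l2_innerBl hp// hq// subrr.
by rewrite opprB addrC addrA subrK.
Qed.

End subspace.
End hilbert.

(** * Coordinate subspaces *)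

Section coordinates.
Context (R : realType) (k : scalar_kind) (E : countType).
Local Notation K := (scalars R k).
Local Notation l2 := (l2 R k E).
Implicit Types (x y z h v : l2) (V S H : set l2) (B : subsets E) (e f : E).

Lemma linear_span_subspace S : submod_closed (mem (linear_span S)).
Proof.
apply/submod_closedP; split=> [V [/submod_closedP[V0 _] _] //|a x y Sx Sy V VS].
have [/submod_closedP[_ VP] _] := VS.
by apply: VP; [exact: Sx|exact: Sy].
Qed.

Lemma coord_subspace_subspace B : submod_closed (mem (@coord_subspace R k E B)).
Proof. exact/closure_subspace/linear_span_subspace. Qed.

Lemma coord_subspace_closed B : closed (@coord_subspace R k E B).
Proof. exact: closed_closure. Qed.

Lemma coord_subspace_supp B x e : coord_subspace B x -> ~ B e -> x e = 0.
Proof.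
move=> /l2_closureP cx nBe; apply: modulus0_eq0; apply/eqP.
rewrite -sqrf_eq0 eq_le sqr_ge0 andbT; apply/ler_addgt0Pr => eps /cx[y Sy xy].
have -> : x e = (x - y) e.
  suff ye : y e = 0 by rewrite [RHS](_ : _ = x e - y e)// ye subr0.
  (* [Sy] puts [y] in every submodule containing the generators; since [e] is not in [B], the
     vectors vanishing at [e] form one. *)
  apply: (Sy [set z : l2 | z e = 0]); split.
    apply/submod_closedP; split=> //= a u v ue ve.
    by rewrite [LHS](_ : _ = a * u e + v e)// ue ve mulr0 addr0.
  move=> _ [f Bf <-] /=; case: eqP => // ef; exfalso; apply: nBe.
  by rewrite ef.
by rewrite add0r; apply: le_trans xy; exact: modulus_nsq_le.
Qed.

Lemma restrict_subproof (P : pred E) x :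
  (fun e => if P e then x e else 0) \in @l2_pred R k E.
Proof.
apply/l2_predP; apply: le_lt_trans (ltry (nsq x)); apply/sqsum_leP => A.
apply: le_trans (sum_nsq_le x A); apply: ler_sum => e _.
by case: ifP => // _; rewrite modulus0 expr0n sqr_ge0.
Qed.

Definition restrict (P : pred E) x : l2 := L2 (restrict_subproof P x).

Lemma nsq_restrict_le (P : pred E) x (c : R) :
  (forall A : {fset E}, {in A, forall e, P e} ->
    \sum_(e <- A) modulus (x e) ^+ 2 <= c) ->
  nsq (restrict P x) <= c.
Proof.
move=> xc; apply: nsq_le => A /=.
rewrite (bigID P)/= [X in _ + X]big1 ?addr0 => [|e /negPf ->]; last first.
  by rewrite modulus0 expr0n.
rewrite (eq_bigr (fun e => modulus (x e) ^+ 2)) => [|e ->//].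
rewrite big_fset_condE.
by apply: xc => e; rewrite !inE => /andP[].
Qed.

Lemma sum_nsq_disjoint x (A B : {fset E}) : [disjoint A & B]%fset ->
  \sum_(e <- A) modulus (x e) ^+ 2 + \sum_(e <- B) modulus (x e) ^+ 2 <= nsq x.
Proof.
move=> /fdisjointP AB; apply: le_trans (sum_nsq_le x (A `|` B)%fset).
rewrite [leRHS](big_fsetID _ (mem A))/= lerD//; apply: sum_fset_le => [e|];
  rewrite ?sqr_ge0//; apply/fsubsetP => e; rewrite !inE.
  by move=> eA; rewrite eA.
by move=> eB; rewrite eB orbT /=; apply/negP => /AB; rewrite eB.
Qed.

(** In the pairing of [v] with [h] the coordinates in [F] other than [e] drop out: [h] vanishes on
    those in [B], and [v] on the rest. Besides the term at [e] there remains a tail of [v], small by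
    the choice of [G], against a part of [h] of norm at most 1. The bound [c] is uniform in [G]. *)
Lemma orthogonal_vanishes H B v e :
  coord_subspace B v -> (forall h, H h -> l2_inner h v = 0) ->
  (exists2 c : R, 0 < c & forall G : {fset E}, exists h (F : {fset E}),
     [/\ H h, (G `\ e `<=` F)%fset, {in F, forall f, B f -> h f = 0},
         c <= modulus (h e) &
         forall A : {fset E}, {in A, forall f, f \notin F} ->
           \sum_(f <- A) modulus (h f) ^+ 2 <= 1]) ->
  v e = 0.
Proof.
move=> Bv vH [c c0 good].
apply: modulus0_eq0; apply/eqP; rewrite -sqrf_eq0 eq_le sqr_ge0 andbT.
apply/ler_addgt0Pr => eps eps0; rewrite add0r.
(* The factor [c ^+ 2] is cancelled at the end against [modulus (h e) ^+ 2]. *)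
have d0 : 0 < eps * c ^+ 2 by rewrite mulr_gt0// exprn_gt0.
have [|G hG] := @sum_nsq_gt _ _ _ v (nsq v - eps * c ^+ 2).
  by rewrite ltrBlDr ltrDl.
have [h [F [Hh GF hF ch hA]]] := good G.
pose P : pred E := [pred f | (f \notin F) && (f != e)].
have w_small : nsq (restrict P v) <= eps * c ^+ 2.
  apply: nsq_restrict_le => A AP.
  suff /(sum_nsq_disjoint v) : [disjoint A & G]%fset by move: hG; lra.
  apply/fdisjointP => f /AP/= /andP[fF fe]; apply: contra fF => fG.
  by apply: (fsubsetP GF); rewrite !inE fe.
have h_small : nsq (restrict P h) <= 1.
  by apply: nsq_restrict_le => A AP; apply: hA => f /AP/andP[].
have : l2_inner v h = v e * sconj (h e) + l2_inner (restrict P v) h.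
  (* Writing the term at [e] as an inner product with [h] reduces the identity to comparing two
     vectors on the support of [h]. *)
  rewrite (_ : sconj (h e) = l2_inner (l2_basis R k e) h); last first.
    by rewrite l2_inner_conj l2_inner_basis.
  rewrite -l2_innerP; apply: l2_inner_local => f hf.
  rewrite [RHS](_ : _ = v e * (f == e)%:R + (if P f then v f else 0))// /P /=.
  have [->|fe] := eqVneq f e; first by rewrite andbF addr0 mulr1.
  rewrite mulr0 add0r andbT; case: ifPn => //; rewrite negbK => fF.
  by apply: (coord_subspace_supp Bv) => Bf; move: hf; rewrite hF ?eqxx.
rewrite l2_inner_conj vH// rmorph0 => /esym/eqP.
rewrite addr_eq0 => /eqP vh.
have : modulus (v e) ^+ 2 * modulus (h e) ^+ 2 <= eps * c ^+ 2.
  rewrite -exprMn -(modulus_sconj (h e)) -modulusM vh modulusN.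
  rewrite l2_inner_conj modulus_sconj (@l2_inner_local _ _ _ _ (restrict P h)).
    apply: le_trans (CauchySchwarz _ _) _; rewrite -[leRHS]mul1r.
    by rewrite ler_pM ?nsq_ge0.
  by move=> f /=; case: ifP => //; rewrite eqxx.
have he : c ^+ 2 <= modulus (h e) ^+ 2.
  by rewrite ler_pXn2r ?nnegrE ?modulus_ge0// (ltW c0).
move=> hh; rewrite -(ler_pM2r (exprn_gt0 2 c0)).
by apply: le_trans hh; rewrite ler_wpM2l ?sqr_ge0.
Qed.

(** Let [q] be the projection of [x] in [[B]] on the compression. Then [x - q] is orthogonal to each
    [P_[B] h], and also to [h - P_[B] h] because it lies in [[B]]; so it is orthogonal to [H] and
    vanishes. *)
Lemma compression_eq_coord_subspace H B : submod_closed (mem H) -> closed H ->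
  (forall v, coord_subspace B v -> (forall h, H h -> l2_inner h v = 0) -> v = 0) ->
  compression H B = coord_subspace B.
Proof.
move=> Hsub Hclosed inj.
have Bsub := coord_subspace_subspace B; have Bclosed := @coord_subspace_closed B.
have projP := orth_projP Bsub Bclosed.
set V := compression H B.
have VB : V `<=` coord_subspace B.
  rewrite [X in _ `<=` X](closure_id _).1//; apply: closure_subset.
  by move=> _ [h _ <-]; exact: (projP h).1.
have Vsub : submod_closed (mem V).
  apply: closure_subspace; apply/submod_closedP; split.
    exists 0; first exact: (subspace0 Hsub).
    apply: orth_proj_uniq => //; first exact: (subspace0 Bsub).
    by move=> v _; rewrite subrr l2_inner0l.
  move=> a _ _ [x Hx <-] [y Hy <-]; exists (a *: x + y); first exact: (subspaceP Hsub).
  apply: orth_proj_uniq => //; first exact: (subspaceP Bsub a (projP x).1 (projP y).1).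
  move=> v Bv; rewrite opprD addrACA -scalerBr l2_innerP.
  transitivity (a * 0 + 0 : K); last by rewrite mulr0 addr0.
  exact: (congr2 (fun s t : K => a * s + t) ((projP x).2 v Bv) ((projP y).2 v Bv)).
have Vclosed : closed V by exact: closed_closure.
apply/seteqP; split=> // x Bx.
have [Vq hq] := orth_projP Vsub Vclosed x.
set q := orth_proj V x in Vq hq.
suff /eqP : x - q = 0 by rewrite subr_eq0 => /eqP ->.
apply: inj => [|h Hh]; first exact: (subspaceB Bsub Bx (VB _ Vq)).
have xqB : coord_subspace B (x - q) by exact: (subspaceB Bsub Bx (VB _ Vq)).
rewrite -[h](subrK (orth_proj (coord_subspace B) h)) l2_innerDl (projP h).2//.
rewrite add0r l2_inner_conj hq ?rmorph0//.
by apply: subset_closure; exists h.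
Qed.

End coordinates.

(** * Cylinder probabilities as determinants *)

(** Rows and columns are permuted alike, so the two signs cancel. Keeping [m] and [n] apart allows
    reindexing by the enumeration of a finite set. *)
Lemma det_mxsub_bij (K : comNzRingType) m n (h : 'I_m -> 'I_n) (A : 'M[K]_n) :
  bijective h -> \det (mxsub h h A) = \det A.
Proof.
move=> h_bij; have mn : m = n by rewrite -[m]card_ord (bij_eq_card h_bij) card_ord.
case: n / mn h A h_bij => h A /bij_inj h_inj; pose s := perm h_inj.
rewrite (_ : mxsub h h A = perm_mx s *m A *m perm_mx s^-1%g).
  rewrite !det_mulmx !det_perm mulrAC odd_permV -signr_addb addbb.
  by rewrite expr0 mul1r.
rewrite -row_permE -col_permE; apply/matrixP => i j; rewrite !mxE.
by rewrite !permE.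
Qed.

Lemma det_delta_row (K : comNzRingType) n (A : 'M[K]_n.+1) i :
  (forall j, A i j = (i == j)%:R) -> \det A = \det (row' i (col' i A)).
Proof.
move=> Ai; rewrite (expand_det_row A i) (bigD1 i)//= big1 ?addr0 => [|j ji].
  rewrite Ai eqxx mul1r /cofactor -signr_odd oddD addbb expr0 mul1r.
  by congr (\det _); apply/matrixP => u v; rewrite !mxE.
by rewrite Ai eq_sym (negPf ji) mul0r.
Qed.

(* Subtracting [x]-multiples of the other columns from the first one. *)
Lemma det_schur (K : comNzRingType) n (q : K) (r : 'rV[K]_n) (M : 'M[K]_n)
    (x : 'cV[K]_n) :
  \det (block_mx q%:M r (M *m x) M) = (q - (r *m x) 0 0) * \det M.
Proof.
have := det_mulmx (block_mx q%:M r (M *m x) M) (block_mx 1%:M 0 (- x) 1%:M).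
rewrite mulmx_block !mulmx1 !mulmx0 !add0r !mulmxN subrr det_ublock.
rewrite det_lblock !det1 !mulr1 => <-.
by rewrite [X in \det X]mx11_scalar det_scalar1 !mxE eqxx mulr1n.
Qed.

Section signed_matrix.
Context (K : comNzRingType) (T : Type) (Q : T -> T -> K).

(* Its determinant is the probability that [g i] belongs to the random set
   exactly when [s i] holds. *)
Definition signed_mx n (g : 'I_n -> T) (s : 'I_n -> bool) : 'M[K]_n :=
  \matrix_(i, j) (if s i then Q (g i) (g j) else (i == j)%:R - Q (g i) (g j)).

Definition force_true n (s : 'I_n -> bool) i0 : 'I_n -> bool :=
  fun i => (i == i0) || s i.

(** Row [i0] is a unit row minus the row obtained by forcing [i0] to true. The determinant is linear
    in it, and expansion along the unit row deletes row and column [i0]. *)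
Lemma det_signed_mx_false n (g : 'I_n.+1 -> T) (s : 'I_n.+1 -> bool) i0 :
  ~~ s i0 ->
  \det (signed_mx g s) =
  \det (signed_mx (g \o lift i0) (s \o lift i0)) -
  \det (signed_mx g (force_true s i0)).
Proof.
move=> si0.
pose B := \matrix_(i, j) (if i == i0 then (i == j)%:R else signed_mx g s i j).
rewrite (@determinant_multilinear _ _ _ B (signed_mx g (force_true s i0)) i0 1 (-1)).
- rewrite mul1r mulN1r; congr (_ - _); rewrite (@det_delta_row _ _ _ i0).
    congr (\det _); apply/matrixP => i j; rewrite !mxE.
    by rewrite eq_sym (negPf (neq_lift _ _)) (inj_eq lift_inj).
  by move=> j; rewrite mxE eqxx.
- apply/rowP => j; rewrite !mxE eqxx (negPf si0) /force_true eqxx/=.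
  by rewrite mul1r mulN1r.
- apply/matrixP => i j; rewrite !mxE eq_sym (negPf (neq_lift _ _)).
  by [].
- apply/matrixP => i j; rewrite !mxE /force_true.
  by rewrite eq_sym (negPf (neq_lift _ _)).
Qed.

End signed_matrix.

Section cylinders.
Context (E : countType).

Definition cylinder n (g : 'I_n -> E) (s : 'I_n -> bool) :
    set (borel_subsets E) :=
  [set B | forall i, (B : subsets E) (g i) = s i].

Lemma measurable_coordinate e (b : bool) :
  measurable [set B : borel_subsets E | (B : subsets E) e = b].
Proof.
apply: sub_sigma_algebra.
apply: (proj1 (continuousP (fun B : subsets E => B e)) _ [set b]).
  exact: (@proj_continuous E (fun _ => bool) e).
exact: discrete_open.
Qed.

Lemma measurable_cylinder n (g : 'I_n -> E) s : measurable (cylinder g s).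
Proof.
rewrite (_ : cylinder g s = \bigcap_(i in [set: 'I_n])
    [set B : borel_subsets E | (B : subsets E) (g i) = s i]).
  apply: fin_bigcap_measurable => // i _; exact: measurable_coordinate.
by apply/seteqP; split=> [B h i _|B h i]; exact: h.
Qed.

(** Set counterpart of [det_signed_mx_false]: the freed coordinate takes one value or the other. *)
Lemma cylinder_split n (g : 'I_n.+1 -> E) s i0 : ~~ s i0 ->
  cylinder (g \o lift i0) (s \o lift i0) =
  cylinder g s `|` cylinder g (force_true s i0).
Proof.
move=> si0; apply/seteqP; split=> B.
  move=> h; case Bi0 : ((B : subsets E) (g i0)); [right|left] => i;
    rewrite /force_true; case: (unliftP i0 i) => [j ->|->].
  - by rewrite eq_sym (negPf (neq_lift _ _)); exact: h.
  - by rewrite eqxx.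
  - exact: h.
  - by rewrite (negPf si0).
case=> h i /=; rewrite h //.
by rewrite /force_true eq_sym (negPf (neq_lift _ _)).
Qed.

Lemma cylinder_disjoint n (g : 'I_n -> E) s t i : s i != t i ->
  cylinder g s `&` cylinder g t = set0.
Proof.
move=> st; rewrite -subset0 => B [/= hs ht].
by move: st; rewrite -hs -ht eqxx.
Qed.

End cylinders.

Section determinantal.
Context (R : realType) (k : scalar_kind) (E : countType).
Local Notation K := (scalars R k).
Local Notation l2 := (l2 R k E).
Context (H : set l2) (Hsub : submod_closed (mem H)) (Hclosed : closed H).
Context (PH : probability (borel_subsets E) R) (PH_law : determinantal_law H PH).

Definition real_prob (A : set (borel_subsets E)) : R := fine (PH A).
Local Notation pr := real_prob.

Definition proj_coef (e f : E) : K := orth_proj H (l2_basis R k f) e.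

Lemma prE A : measurable A -> PH A = (pr A)%:E.
Proof. by move=> mA; rewrite fineK// fin_num_measure. Qed.

Lemma pr_ge0 A : 0 <= pr A. Proof. exact: fine_ge0. Qed.

Lemma prU A B : measurable A -> measurable B -> A `&` B = set0 ->
  pr (A `|` B) = pr A + pr B.
Proof.
move=> mA mB AB; apply: EFin_inj; rewrite EFinD -!prE//; last exact: measurableU.
exact: measureU.
Qed.

Lemma pr_le A B : measurable A -> measurable B -> A `<=` B -> pr A <= pr B.
Proof.
by move=> mA mB AB; rewrite -lee_fin -!prE//; apply: le_measure; rewrite ?in_setE.
Qed.

Lemma pr_cylinder_true n (g : 'I_n -> E) : injective g ->
  of_real k (pr (cylinder g (fun=> true))) = \det (signed_mx proj_coef g (fun=> true)).
Proof.
move=> g_inj; pose A := [fset g i | i in 'I_n]%fset.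
have gA i : g i \in A by apply/imfsetP; exists i.
rewrite (_ : cylinder g _ = [set B | forall e, e \in A -> (B : subsets E) e]).
  (* The law has [(P_H e_i, e_j)] at position [(i, j)], whereas [proj_coef] takes the projected
     basis vector as second argument; hence the transpose. *)
  rewrite /real_prob PH_law -det_tr.
  have /choice[h hE] (i : 'I_#|{: A}|) : exists j, g j = val (enum_val i).
    by have /imfsetP[j _ ->] := valP (enum_val i); exists j.
  have h_bij : bijective h.
    exists (fun j => enum_rank [` gA j]%fset) => i.
      by apply: enum_val_inj; rewrite enum_rankK; apply: val_inj; rewrite /= hE.
    by apply: g_inj; rewrite hE enum_rankK.
  rewrite -(det_mxsub_bij _ h_bij); congr (\det _).
  by apply/matrixP => i j; rewrite !mxE !hE l2_inner_basis.
apply/seteqP; split=> B h.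
  by move=> _ /imfsetP[i _ ->]; rewrite h.
by move=> i; exact: h.
Qed.

(** Induction on the number of false signs: probabilities and determinants obey the same recursion,
    whose two terms both have fewer false signs. *)
Lemma pr_cylinder n (g : 'I_n -> E) s : injective g ->
  of_real k (pr (cylinder g s)) = \det (signed_mx proj_coef g s).
Proof.
have [m] := ubnP #|[pred i | ~~ s i]|; elim: m n g s => // m IH n g s hm g_inj.
have [[i0 si0]|nfalse] := pselect (exists i, ~~ s i); last first.
  suff -> : s = fun=> true by exact: pr_cylinder_true.
  by apply/funext => i; apply/negPn/negP => si; apply: nfalse; exists i.
case: n i0 g s hm g_inj si0 => [[]//|n] i0 g s hm g_inj si0.
have mC := measurable_cylinder.
have := cylinder_split g si0.
move=> /(congr1 pr); rewrite prU//; last first.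
  by apply: (@cylinder_disjoint _ _ _ _ _ i0); rewrite /force_true eqxx (negPf si0).
move=> /(congr1 (of_real k)); rewrite of_realD (det_signed_mx_false _ _ si0).
rewrite (IH _ _ (s \o lift i0)) ?(IH _ _ (force_true s i0))//.
- by move=> ->; rewrite addrK.
- apply: leq_trans (ltnSE hm); apply: proper_card; apply/properP; split.
    by apply/fintype.subsetP => i; rewrite !inE negb_or => /andP[].
  by exists i0; rewrite !inE/= ?/force_true ?eqxx.
- apply: leq_trans (ltnSE hm); rewrite -(fintype.card_image (@lift_inj _ i0)).
  apply: proper_card.
  apply/properP; split.
    by apply/fintype.subsetP => i /fintype.imageP[j js ->]; move: js; rewrite !inE.
  exists i0; rewrite ?inE//; apply/fintype.imageP => -[j _ /eqP].
  by rewrite (negPf (neq_lift _ _)).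
- by move=> i j /= /g_inj /lift_inj.
Qed.

End determinantal.

(** * Conditioning on a finite trace *)

(** The domain is written ['I_(1 + n)] so that matrices indexed by it split into blocks. *)
Definition fcons (T : Type) n (a : T) (g : 'I_n -> T) : 'I_(1 + n) -> T :=
  fun i => match fintype.split i with inl _ => a | inr j => g j end.

Lemma fcons_lshift (T : Type) n (a : T) (g : 'I_n -> T) i :
  fcons a g (lshift n i) = a.
Proof. by rewrite /fcons (unsplitK (inl i)). Qed.

Lemma fcons_rshift (T : Type) n (a : T) (g : 'I_n -> T) i :
  fcons a g (rshift 1 i) = g i.
Proof. by rewrite /fcons (unsplitK (inr i)). Qed.

Lemma fcons_inj (T : Type) n (a : T) (g : 'I_n -> T) :
  injective g -> (forall i, g i <> a) -> injective (fcons a g).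
Proof.
move=> g_inj ga i j; case: (split_ordP i) => i' ->; case: (split_ordP j) => j' ->;
  rewrite ?fcons_lshift ?fcons_rshift.
- by rewrite !ord1.
- by move/esym/ga.
- by move/ga.
- by move/g_inj ->.
Qed.

(** Brings the matrix of the enlarged cylinder into the form required by [det_schur]. *)
Lemma signed_mx_cons (K : comNzRingType) (T : Type) (Q : T -> T -> K) n a
    (g : 'I_n -> T) s :
  signed_mx Q (fcons a g) (fcons true s) =
  block_mx (Q a a)%:M (\row_j Q a (g j))
    (\col_i (if s i then Q (g i) a else - Q (g i) a)) (signed_mx Q g s).
Proof.
rewrite -[LHS]submxK; congr block_mx; apply/matrixP => i j;
  rewrite !mxE ?fcons_lshift ?fcons_rshift//=.
- by rewrite !ord1 eqxx mulr1n.
- by rewrite eq_rlshift sub0r.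
Qed.

Section conditioning.
Context (R : realType) (k : scalar_kind) (E : countType).
Local Notation K := (scalars R k).
Local Notation l2 := (l2 R k E).
Context (H : set l2) (Hsub : submod_closed (mem H)) (Hclosed : closed H).
Context (PH : probability (borel_subsets E) R) (PH_law : determinantal_law H PH).
Local Notation pr := (real_prob PH).
Local Notation Q := (proj_coef H).

Lemma cylinder_cons n (g : 'I_n -> E) s e :
  cylinder (fcons e g) (fcons true s) =
  cylinder g s `&` [set B | (B : subsets E) e].
Proof.
apply/seteqP; split=> B.
  move=> h; split=> [i|/=].
    by have := h (rshift 1 i); rewrite !fcons_rshift.
  by have := h (lshift n ord0); rewrite !fcons_lshift.
move=> [h /= Be] i; case: (split_ordP i) => i' ->;
  by rewrite ?fcons_lshift ?fcons_rshift.
Qed.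

(* If [M] is the signed matrix of [(g, s)] and [x] solves [M x = b], where [b]
   is the signed column of [e], then [P_H (e - \sum_i x_i g_i)] has the required
   properties, its coordinate at [e] being a Schur complement. *)
Lemma conditional_vector n (g : 'I_n -> E) s e :
  injective g -> (forall i, g i <> e) -> 0 < pr (cylinder g s) ->
  let c := pr (cylinder g s `&` [set B | (B : subsets E) e]) / pr (cylinder g s) in
  exists h, [/\ H h, forall i, s i -> h (g i) = 0, h e = of_real k c &
    forall A : {fset E}, (forall i, g i \notin A) ->
      \sum_(f <- A) modulus (h f) ^+ 2 <= c].
Proof.
move=> g_inj ge p0 c.
pose p := pr (cylinder g s).
pose M := signed_mx Q g s.
(* Positive probability of the cylinder is what makes the linear system solvable. *)
have detM : \det M = of_real k p by rewrite -(pr_cylinder PH_law).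
have M_unit : M \in unitmx.
  by rewrite unitmxE detM unitfE -(of_real0 R k) (inj_eq (@of_real_inj R k)) gt_eqF.
pose b := \col_i (if s i then Q (g i) e else - Q (g i) e).
have [x Mx] : exists x, M *m x = b by exists (invmx M *m b); rewrite mulKVmx.
pose px f := orth_proj H (l2_basis R k f).
have pxP f : H (px f) /\ forall u, H u -> l2_inner (l2_basis R k f - px f) u = 0.
  exact: orth_projP.
have [h hdef] : exists h : l2, h = px e - \sum_i x i 0 *: px (g i).
  by eexists.
have hE f : h f = Q f e - \sum_i x i 0 * Q f (g i).
  rewrite hdef -[LHS]l2_inner_basis l2_innerBl l2_inner_suml !l2_inner_basis.
  by congr (_ - _); apply: eq_bigr => i _; rewrite l2_innerZl l2_inner_basis.
have h_true i : s i -> h (g i) = 0.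
  move=> si; have /matrixP/(_ i 0) := Mx.
  rewrite !mxE si hE => <-; apply/eqP; rewrite subr_eq0; apply/eqP.
  by apply: eq_bigr => j _; rewrite mxE si mulrC.
(* In a row with false sign the identity part of [M] isolates [x i 0]. *)
have h_false i : ~~ s i -> h (g i) = - x i 0.
  move=> si; have /matrixP/(_ i 0) := Mx.
  rewrite !mxE (negPf si) hE => /(congr1 -%R); rewrite opprK => <-.
  under eq_bigr do rewrite mxE (negPf si) mulrBl.
  rewrite sumrB opprB [X in _ - X - _](_ : _ = x i 0).
    by rewrite addrAC; under eq_bigr do rewrite mulrC; rewrite subrr add0r.
  rewrite (bigD1 i)//= eqxx mul1r big1 ?addr0 => [//|j ji].
  by rewrite eq_sym (negPf ji) mul0r.
(* [det_schur] gives the probability of the enlarged cylinder as [h e * \det M]. *)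
have he : h e = of_real k c.
  apply: (@mulIf _ (of_real k p)).
    by rewrite -(of_real0 R k) (inj_eq (@of_real_inj R k)) gt_eqF.
  rewrite -of_realM divfK ?gt_eqF// -cylinder_cons.
  rewrite (pr_cylinder PH_law); last exact: fcons_inj.
  rewrite signed_mx_cons -/M -/b -[b]Mx det_schur detM hE; congr ((_ - _) * _).
  by rewrite mxE; apply: eq_bigr => i _; rewrite mxE mulrC.
have Hh : H h.
  rewrite hdef; apply: (subspaceB Hsub) (pxP e).1 _; apply: (subspace_sum Hsub) => i.
  exact: (subspaceZ Hsub _ (pxP (g i)).1).
(* As [h] lies in [H], projections may be dropped from one factor of [l2_inner h h]. This leaves
   [h e] and the products of [- x i 0] with the conjugate of [h (g i)]: zero at true signs, squared
   moduli at false ones. *)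
have nsq_h : nsq h = c + \sum_i modulus (h (g i)) ^+ 2.
  apply: (@of_real_inj R k); rewrite -l2_innerxx.
  have -> : l2_inner h h =
      l2_inner (l2_basis R k e - \sum_i x i 0 *: l2_basis R k (g i)) h.
    apply/eqP; rewrite -subr_eq0 -opprB oppr_eq0 -l2_innerBl.
    rewrite (_ : _ - h = (l2_basis R k e - px e) -
        \sum_i x i 0 *: (l2_basis R k (g i) - px (g i))).
      rewrite l2_innerBl (pxP e).2// l2_inner_suml big1 ?subrr// => i _.
      by rewrite l2_innerZl (pxP (g i)).2// mulr0.
    under [in RHS]eq_bigr do rewrite scalerBr.
    rewrite sumrB hdef !opprB [X in _ + X = _]addrC [LHS]addrACA.
    by congr (_ + _); rewrite addrC.
  have innerb f : l2_inner (l2_basis R k f) h = sconj (h f).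
    by rewrite l2_inner_conj l2_inner_basis.
  rewrite l2_innerBl innerb he sconj_of_real l2_inner_suml rmorphD/= rmorph_sum/=.
  rewrite -sumrN; congr (_ + _); apply: eq_bigr => i _.
  rewrite l2_innerZl innerb -mul_sconj; have [si|si] := boolP (s i).
    by rewrite h_true// rmorph0 !mulr0 oppr0.
  by rewrite h_false// mulNr.
exists h; split=> // A gA.
pose F := [fset g i | i in 'I_n]%fset.
have AF : [disjoint A & F]%fset.
  apply/fdisjointP => f fA; apply/negP => /imfsetP[i _ fE].
  by have := gA i; rewrite -fE fA.
have := sum_nsq_disjoint h AF; rewrite nsq_h big_imfset/=; last by move=> ? ? _ _ /g_inj.
by rewrite big_enum/= lerD2r.
Qed.

End conditioning.

(** * Exceptional sets *)

Section eventually_small.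
Context (d : measure_display) (T : measurableType d) (R : realType).
Context (mu : {measure set T -> \bar R}).

Definition liminf_set (A : nat -> set T) : set T :=
  \bigcup_m \bigcap_(n in [set n | (m <= n)%N]) A n.

Lemma measurable_liminf_set A :
  (forall n, measurable (A n)) -> measurable (liminf_set A).
Proof.
by move=> mA; apply: bigcupT_measurable => m; apply: bigcap_measurableType.
Qed.

(** The tail intersections increase to the lower limit and each lies inside some [A n], so
    continuity from below applies. *)
Lemma measure_liminf_set_le A (c : \bar R) : (forall n, measurable (A n)) ->
  (forall n, (mu (A n) <= c)%E) -> (mu (liminf_set A) <= c)%E.
Proof.
move=> mA Ac.
pose F m := \bigcap_(n in [set n | (m <= n)%N]) A n.
have mF m : measurable (F m) by exact: bigcap_measurableType.
have Fc : mu \o F @ \oo --> mu (\bigcup_m F m).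
  apply: nondecreasing_cvg_mu => //; first exact: bigcupT_measurable.
  move=> m n mn; apply/subsetPset => x Fx i /= ni.
  by apply: Fx; exact: leq_trans ni.
rewrite [leLHS](_ : _ = mu (\bigcup_m F m))// -(cvg_lim _ Fc)//.
apply: lime_le; first by apply/cvg_ex; eexists; exact: Fc.
near=> n; apply: le_trans (Ac n); apply: le_measure; rewrite ?in_setE//.
by move=> x; apply => /=.
Unshelve. all: by end_near. Qed.

End eventually_small.

Section null_sets.
Context (R : realType) (E : countType).
Context (PH : probability (borel_subsets E) R).
Local Notation pr := (real_prob PH).
Implicit Type e : E.

Definition containing e : set (borel_subsets E) := [set B | (B : subsets E) e].

Lemma measurable_containing e : measurable (containing e).
Proof. exact: (measurable_coordinate e true). Qed.

(** Distinct sign patterns give disjoint cylinders, so the sum is the probability of their union. *)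
Lemma sum_pr_cylinder_le1 n (g : 'I_n -> E) :
  \sum_(s : {ffun 'I_n -> bool}) pr (cylinder g s) <= 1.
Proof.
have mC (s : 'I_n -> bool) : measurable (cylinder g s) by exact: measurable_cylinder.
suff -> : \sum_(s : {ffun 'I_n -> bool}) pr (cylinder g s) =
    pr (\big[setU/set0]_(s : {ffun 'I_n -> bool}) cylinder g s).
  rewrite -lee_fin -prE; last exact: bigsetU_measurable.
  by apply: probability_le1; exact: bigsetU_measurable.
elim: index_enum (index_enum_uniq {ffun 'I_n -> bool}) => [|s r IH] /=.
  by rewrite !big_nil /real_prob measure0.
move=> /andP[sr ur]; rewrite !big_cons prU ?IH//; first exact: bigsetU_measurable.
rewrite -subset0 -bigcup_seq => B [Bs [t /= tr Bt]].
suff st : s = t by rewrite st tr in sr.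
by apply/ffunP => i; rewrite -Bs -Bt.
Qed.

(* The event that [e] belongs to the random set although this had conditional
   probability at most [eps] given the trace on the range of [g]. *)
Definition surprising n (g : 'I_n -> E) e (eps : R) : set (borel_subsets E) :=
  \big[setU/set0]_(s : {ffun 'I_n -> bool} |
      pr (cylinder g s `&` containing e) <= eps * pr (cylinder g s))
    (cylinder g s `&` containing e).

Lemma measurable_surprising n (g : 'I_n -> E) e eps :
  measurable (surprising g e eps).
Proof.
apply: bigsetU_measurable => s _; apply: measurableI.
  exact: measurable_cylinder.
exact: measurable_containing.
Qed.

(** Subadditivity over the patterns: each contributes at most [eps] times the probability of its
    cylinder. *)
Lemma pr_surprising_le n (g : 'I_n -> E) e eps : 0 <= eps ->
  (PH (surprising g e eps) <= eps%:E)%E.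
Proof.
move=> eps0; have mCe (s : 'I_n -> bool) : measurable (cylinder g s `&` containing e).
  by apply: measurableI; [exact: measurable_cylinder|exact: measurable_containing].
have leU : (PH (surprising g e eps) <= (\sum_(s : {ffun 'I_n -> bool} |
      (pr (cylinder g s `&` containing e) <= eps * pr (cylinder g s))%R)
    pr (cylinder g s `&` containing e))%:E)%E.
  (* Measurability is carried through the induction because subadditivity asks for it. *)
  suff [] : measurable (surprising g e eps) /\ (PH (surprising g e eps) <=
      (\sum_(s : {ffun 'I_n -> bool} |
        (pr (cylinder g s `&` containing e) <= eps * pr (cylinder g s))%R)
      pr (cylinder g s `&` containing e))%:E)%E by [].
  rewrite /surprising.
  apply: (big_ind2 (fun A (x : R) => measurable A /\ (PH A <= x%:E)%E)).
  - by rewrite measure0.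
  - move=> A x B y [mA Ax] [mB By]; split; first exact: measurableU.
    by rewrite EFinD; apply: le_trans (measureU2 _ mA mB) _; exact: leeD.
  - by move=> s _; split=> //; rewrite prE.
apply: le_trans leU _; rewrite lee_fin.
apply: (@le_trans _ _ (\sum_(s : {ffun 'I_n -> bool}) eps * pr (cylinder g s))).
  rewrite big_mkcond; apply: ler_sum => s _; case: ifP => // _.
  by rewrite mulr_ge0// pr_ge0.
by rewrite -mulr_sumr -[leRHS]mulr1 ler_wpM2l// sum_pr_cylinder_le1.
Qed.

(** [B] lies in the cylinder of its own trace, so that pattern cannot be among those united in
    [surprising]. *)
Lemma not_surprising n (g : 'I_n -> E) e eps (B : borel_subsets E) :
  containing e B -> ~ surprising g e eps B ->
  let s := (B : subsets E) \o g in
  eps * pr (cylinder g s) < pr (cylinder g s `&` containing e).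
Proof.
move=> Be; apply: contra_notP => /negP; rewrite -leNgt => small.
have sE : [ffun i => (B : subsets E) (g i)] = (B : subsets E) \o g :> ('I_n -> bool).
  by apply/funext => i; rewrite ffunE.
by rewrite /surprising (bigD1 [ffun i => (B : subsets E) (g i)]) sE//; left.
Qed.

(** The event that [e] is present although its conditional probabilities given the traces on the
    ranges of [g n] tend to 0. *)
Definition exceptional (m : nat -> nat) (g : forall n, 'I_(m n) -> E) e :
    set (borel_subsets E) :=
  \bigcap_j liminf_set (fun n => surprising (g n) e j.+1%:R^-1).

Lemma measurable_exceptional m (g : forall n, 'I_(m n) -> E) e :
  measurable (exceptional g e).
Proof.
apply: bigcapT_measurable => j; apply: measurable_liminf_set => n.
exact: measurable_surprising.
Qed.

(** For every [j] the event lies in a lower limit of events of probability at most [j.+1%:R^-1]. *)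
Lemma exceptional_null m (g : forall n, 'I_(m n) -> E) e :
  PH (exceptional g e) = 0%E.
Proof.
have mex := measurable_exceptional g e.
have le j : (PH (exceptional g e) <= (j.+1%:R^-1)%:E)%E.
  have mS n : measurable (surprising (g n) e j.+1%:R^-1).
    exact: measurable_surprising.
  apply: (@le_trans _ _ (PH (liminf_set (fun n => surprising (g n) e j.+1%:R^-1)))).
    apply: le_measure; rewrite ?in_setE//; first exact: measurable_liminf_set.
    by move=> B; apply.
  by apply: measure_liminf_set_le => // n; exact: pr_surprising_le.
apply/eqP; rewrite eq_le measure_ge0 andbT; apply/lee_addgt0Pr => eps eps0.
rewrite add0e; have [N _ /(_ N (leqnn N))/ltW hN] := near_infty_natSinv_lt (PosNum eps0).
by apply: le_trans (le N) _; rewrite lee_fin.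
Qed.

End null_sets.

(** * Exhausting [E] without [e] by finite sets *)

Section exhaustion.
Context (E : countType).
Implicit Types e f : E.

(** [undup] guards against several codes decoding to one element, since the enumeration has to be
    injective. *)
Definition initial_seq e (n : nat) : seq E :=
  [seq f <- undup (pmap choice.unpickle (iota 0 n)) | f != e].

Lemma initial_seq_uniq e n : uniq (initial_seq e n).
Proof. by rewrite filter_uniq ?undup_uniq. Qed.

Lemma initial_seqN e n : e \notin initial_seq e n.
Proof. by rewrite mem_filter eqxx. Qed.

Lemma mem_initial_seq e n f : f != e -> (choice.pickle f < n)%N -> f \in initial_seq e n.
Proof.
move=> fe fn; rewrite mem_filter fe mem_undup mem_pmap; apply/mapP.
by exists (choice.pickle f); rewrite ?mem_iota ?choice.pickleK.
Qed.

Definition initial_fun e n : 'I_(size (initial_seq e n)) -> E :=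
  tnth (in_tuple (initial_seq e n)).

Lemma initial_fun_inj e n : injective (@initial_fun e n).
Proof. by apply/tuple_uniqP; exact: initial_seq_uniq. Qed.

Lemma mem_initial_fun e n i : @initial_fun e n i \in initial_seq e n.
Proof. exact: mem_tnth. Qed.

Lemma initial_funP e n f : f \in initial_seq e n -> exists i, @initial_fun e n i = f.
Proof. by move=> /seq_tnthP[i ->]; exists i. Qed.

End exhaustion.

(** * Almost sure vanishing of vectors of [[B]] orthogonal to [H] *)

Section almost_sure.
Context (R : realType) (k : scalar_kind) (E : countType).
Local Notation l2 := (l2 R k E).
Context (H : set l2) (Hsub : submod_closed (mem H)) (Hclosed : closed H).
Context (PH : probability (borel_subsets E) R) (PH_law : determinantal_law H PH).

Local Notation pr := (real_prob PH).

Lemma vanishes_off_exceptional (B : subsets E) (v : l2) e :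
  coord_subspace B v -> (forall h, H h -> l2_inner h v = 0) ->
  ~ exceptional PH (@initial_fun E e) e B -> v e = 0.
Proof.
move=> Bv vH Bex; have [Be|nBe] := pselect (B e); last exact: coord_subspace_supp Bv nBe.
apply: (orthogonal_vanishes Bv vH).
(* [j.+1%:R^-1] becomes the uniform lower bound: it is exceeded by the conditional probability of
   [e] for arbitrarily large [n]. *)
have [j nj] : exists j, ~ liminf_set
    (fun n => surprising PH (@initial_fun E e n) e j.+1%:R^-1) B.
  by apply/existsNP => h; apply: Bex => j _; exact: h.
exists j.+1%:R^-1 => [|G]; first by rewrite invr_gt0.
(* From [m] on, the initial sequences contain all of [G] except possibly [e]. *)
pose m := \max_(f <- G) (choice.pickle f).+1.
have [n mn Bn] : exists2 n, (m <= n)%N &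
    ~ surprising PH (@initial_fun E e n) e j.+1%:R^-1 B.
  apply: contrapT => h; apply: nj; exists m => // n /= mn.
  by apply: contrapT => hn; apply: h; exists n.
set g := @initial_fun E e n in Bn.
have := not_surprising Be Bn; set s := (_ \o g) => /= hs.
have mC := measurable_cylinder g s; have me := measurable_containing e.
(* The strict inequality also forces the cylinder to have positive probability, so conditioning on
   it is legitimate. *)
have p'0 : 0 < pr (cylinder g s `&` containing e).
  by apply: le_lt_trans hs; rewrite mulr_ge0 ?pr_ge0 ?invr_ge0.
have p'p : pr (cylinder g s `&` containing e) <= pr (cylinder g s).
  by apply: pr_le => //; exact: measurableI.
have p0 := lt_le_trans p'0 p'p.
have ge i : g i <> e.
  by move=> gi; have := initial_seqN e n; rewrite -{1}gi mem_initial_fun.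
have [h [Hh hs0 he hA]] := conditional_vector Hsub Hclosed PH_law
  (@initial_fun_inj E e n) ge p0.
have c0 : 0 < pr (cylinder g s `&` containing e) / pr (cylinder g s).
  by rewrite divr_gt0.
exists h, [fset f in initial_seq e n]%fset; split=> //.
- apply/fsubsetP => f; rewrite !inE => /andP[fe fG].
  apply: mem_initial_seq => //; apply: leq_trans mn; rewrite /m.
  by rewrite (big_fsetD1 f)//= leq_maxl.
- by move=> f; rewrite inE => /initial_funP[i <-] Bf; exact: hs0.
- by rewrite he modulus_of_real gtr0_norm// ler_pdivlMr// ltW.
(* The squared norm off [F] is at most a conditional probability, hence at most 1. *)
- move=> A AF; apply: le_trans (hA A _) _; last by rewrite ler_pdivrMr// mul1r.
  by move=> i; apply/negP => /AF; rewrite inE mem_initial_fun.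
Qed.

End almost_sure.

Theorem theorem7p2 (R : realType) (k : scalar_kind) (E : countType)
  (H : set (l2 R k E)) (H_subspace : submod_closed (mem H))
  (H_closed : closed H)
  (PH : probability (borel_subsets E) R) (PH_law : determinantal_law H PH)
  (d : measure_display) (Omega : measurableType d) (Pr : probability Omega R)
  (frakB : {RV Pr >-> borel_subsets E})
  (frakB_law : forall A, measurable A -> distribution Pr frakB A = PH A) :
  {ae Pr, forall w, compression H (frakB w) = coord_subspace (frakB w)}.
Proof.
(* One exceptional event for each code of an element of [E]; a code that decodes to nothing
   contributes the empty set. *)
pose N (i : nat) : set Omega := if choice.unpickle i is Some e
  then frakB @^-1` exceptional PH (@initial_fun E e) e else set0.
have N_null i : Pr.-negligible (N i).
  rewrite /N; case: choice.unpickle => [e|]; last exact: negligible_set0.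
  have mex := measurable_exceptional PH (@initial_fun E e) e.
  apply/negligibleP; first exact: (measurable_funPTI frakB).
  by rewrite -[LHS]/(distribution Pr frakB _) frakB_law// exceptional_null.
(* Off the countable union every coordinate of a vector of [[B]] orthogonal to [H] vanishes, so the
   set where the equality fails lies in that union. *)
apply: negligibleS (negligible_bigcup N_null) => w /= neq.
apply: contrapT => wN; apply: neq.
apply: compression_eq_coord_subspace => // v Bv vH.
apply/val_inj/funext => e; apply: (vanishes_off_exceptional _ _ PH_law Bv vH) => // ex.
by apply: wN; exists (choice.pickle e) => //; rewrite /N choice.pickleK.
Qed.
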